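(* Let $N,m\ge 1$ be integers, let $\beta,\mu_w>0$, let $x_0\in\mathbb{R}^{r_0}$ be fixed, let $H_j:\mathbb{R}^{s_j}\times\mathbb{R}^{r_{j-1}}\to\mathbb{R}^{r_j}$, $j=1,\dots,N+1$, be continuously differentiable functions, let $\lambda=(\lambda_1,\dots,\lambda_N)$ with $\lambda_j\in\mathbb{R}^{r_j}$, and let $y\in\mathbb{R}^{r_{N+1}}$. Consider the unconstrained minimization over $z=(w,x)$, with $w=(w_1,\dots,w_{N+1})$, $w_j\in\mathbb{R}^{s_j}$, and $x=(x_1,\dots,x_N)$, $x_j\in\mathbb{R}^{r_j}$, of $$\mathcal{L}_\beta(z,\lambda)=\tfrac{1}{2m}\|H_{N+1}(w_{N+1},x_N)-y\|^2+\tfrac{\mu_w}{2}\|w\|^2-\tfrac{1}{2\beta}\|\lambda\|^2+\tfrac{\beta}{2}\sum_{j=1}^N\big\|x_j-H_j(w_j,x_{j-1})+\tfrac{1}{\beta}\lambda_j\big\|^2 .$$ Then, for any initial point $z^0$, any $\eta_1,\eta_2\in(0,1)$ and any $\varepsilon>0$, the Gauss-Newton algorithm described in the context terminates in finite time (after finitely many iterations) and returns an $\varepsilon$-stationary solution, i.e. a point $z$ with $\|\nabla_z\mathcal{L}_\beta(z,\lambda)\|_\infty\le\varepsilon$.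
   Context: $\|\cdot\|$ is the Euclidean norm, $\|\cdot\|_\infty$ the max norm, and $\mathrm{J}_{u}H$ denotes the partial Jacobian of $H$ with respect to the variable $u$. Given matrices $A_j\in\mathbb{R}^{r_j\times r_{j-1}}$, $B_j\in\mathbb{R}^{r_j\times s_j}$ and vectors $c_j\in\mathbb{R}^{r_j}$, $j=1,\dots,N+1$, write $\mathcal{A}=(A_1,\dots,A_{N+1})$, $\mathcal{B}=(B_1,\dots,B_{N+1})$, $c=(c_1,\dots,c_{N+1})$ and define, for $z=(w,x)$, $$\mathcal{G}_{\mathcal{A},\mathcal{B},c}(z)=\sum_{j=1}^{N+1}\Big(\tfrac{\rho_j}{2}\|\delta_jx_j-A_jx_{j-1}-B_jw_j-c_j\|^2+\tfrac{\mu_w}{2}\|w_j\|^2\Big),$$ where $(\delta_j,\rho_j)=(1,\beta)$ for $j\le N$ and $(\delta_{N+1},\rho_{N+1})=(0,\tfrac1m)$ (so the term $\delta_{N+1}x_{N+1}$ is absent). At a point $z^l=(w^l,x^l)$ (with $x_0^l=x_0$) the linearization data are: $A_1=0$ and $A_{j+1}=\mathrm{J}_{x_j}H_{j+1}(w_{j+1}^l,x_j^l)$ for $j=1,\dots,N$; $B_j=\mathrm{J}_{w_j}H_j(w_j^l,x_{j-1}^l)$ for $j=1,\dots,N+1$; $c_j=H_j(w_j^l,x_{j-1}^l)-A_jx_{j-1}^l-B_jw_j^l-\tfrac1\beta\lambda_j$ for $j=1,\dots,N$; and $c_{N+1}=H_{N+1}(w_{N+1}^l,x_N^l)-A_{N+1}x_N^l-B_{N+1}w_{N+1}^l-y$.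 Gauss-Newton algorithm. Input: $z^0=(w^0,x^0)$, $\eta_1,\eta_2\in(0,1)$, tolerance $\varepsilon>0$. For $l=0,1,2,\dots$: 1. Set $p^l=\bar z^l-z^l$, where $\bar z^l$ is the minimizer of $\mathcal{G}_{\mathcal{A},\mathcal{B},c}$ with $\mathcal{A},\mathcal{B},c$ the linearization data at $z^l$. 2. Set $z^{l+1}=z^l+\tau_lp^l$, where $\tau_l$ is the largest number in $\{1,\eta_1,\eta_1^2,\dots\}$ such that $$\mathcal{L}_\beta(z^l+\tau_lp^l,\lambda)\le\mathcal{L}_\beta(z^l,\lambda)-\eta_2\tau_l\,\mathcal{G}_{\mathcal{A},\mathcal{B},0}(p^l),$$ with $\mathcal{A},\mathcal{B}$ the linearization data at $z^l$ (since $A_1=0$, the value of $\mathcal{G}_{\mathcal{A},\mathcal{B},0}(p^l)$ does not depend on $x_0$). 3. If $\|\nabla_z\mathcal{L}_\beta(z^{l+1},\lambda)\|_\infty\le\varepsilon$, stop and return $z^{l+1}$. *)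

(* Defs.v *)
From HB Require Import structures.
From mathcomp Require Export all_boot all_order all_algebra.
From mathcomp Require Export all_classical all_reals all_analysis.

Set Implicit Arguments.
Unset Strict Implicit.
Unset Printing Implicit Defensive.

Import Order.TTheory GRing.Theory Num.Theory.
Import numFieldNormedType.Exports.

Local Open Scope classical_set_scope.
Local Open Scope ring_scope.

(* Vectors are row vectors and matrices act on the right, as for the library's
   Jacobian: the R^(p x q) matrix A of a linear map v |-> A v is represented by
   its transpose in 'M[R]_(q, p), and A v is written v *m A.
   The library norm `|v| on 'rV[R]_n is the max norm. *)

Section Vectors.
Variable R : realType.

Definition enorm n (v : 'rV[R]_n) : R := Num.sqrt (\sum_(i < n) v 0 i ^+ 2).

Definition grad n (f : 'rV[R]_n -> R) (z : 'rV[R]_n) : 'rV[R]_n :=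
  \row_(i < n) 'D_(delta_mx 0 i) f z.

Definition C1 p q n (f : 'rV[R]_p -> 'rV[R]_q -> 'rV[R]_n) : Prop :=
  let F := fun u : 'rV[R]_(p + q) => f (lsubmx u) (rsubmx u) in
  (forall u, differentiable F u) /\ continuous (fun u => 'J F u).

(* The j-th block of the concatenation v = (v_0, ..., v_(n-1)), v_i in R^(d i),
   extended by 0 for j >= n so that j can be a plain natural number. *)
Definition block (d : nat -> nat) n (v : 'rV[R]_(\sum_(i < n) d i)) (j : nat) :
    'rV[R]_(d j) :=
  if @idP (j < n)%N is ReflectT jn then submxrow v (Ordinal jn) else 0.

End Vectors.

(* Layers are numbered from 0 to N: [H j], with weights in R^(s j), maps the
   state in R^(r j) to the state in R^(r j.+1). Thus [H j], [s j], [A j], [B j],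
   [c j] and [w_ z j] carry the one-based index j + 1, while the states
   [x_ z 0] = x0, [x_ z 1], ..., [x_ z N] keep their usual index. The families
   are indexed by nat, but only the values with j <= N are ever used. *)
Section GaussNewton.
Variables (R : realType) (N m : nat) (r s : nat -> nat).
Variable H : forall j : nat, 'rV[R]_(s j) -> 'rV[R]_(r j) -> 'rV[R]_(r j.+1).
Arguments H : clear implicits.
Variable x0 : 'rV[R]_(r 0%N).
Variable lambda : 'rV[R]_(\sum_(i < N) r i.+1).
Variable y : 'rV[R]_(r N.+1).
Variables beta mu_w : R.

Definition var := 'rV[R]_(\sum_(i < N.+1) s i + \sum_(i < N) r i.+1).

Definition w_ (z : var) (j : nat) : 'rV[R]_(s j) :=
  @block R s N.+1 (lsubmx z) j.

(* The value for j > N is 0; it only occurs multiplied by [delta N] = 0. *)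
Definition x_ (z : var) (j : nat) : 'rV[R]_(r j) :=
  match j with
  | 0 => x0
  | k.+1 => @block R (fun i => r i.+1) N (rsubmx z) k
  end.

Definition lambda_ (j : nat) : 'rV[R]_(r j.+1) :=
  @block R (fun i => r i.+1) N lambda j.

Definition Lagr (z : var) : R :=
  (2 * m%:R)^-1 * enorm (H N (w_ z N) (x_ z N) - y) ^+ 2
  + mu_w / 2 * enorm (lsubmx z) ^+ 2
  - (2 * beta)^-1 * enorm lambda ^+ 2
  + beta / 2 *
    \sum_(j < N) enorm (x_ z j.+1 - H j (w_ z j) (x_ z j)
                        + beta^-1 *: lambda_ j) ^+ 2.

Definition delta (j : nat) : R := if (j < N)%N then 1 else 0.
Definition rho (j : nat) : R := if (j < N)%N then beta else m%:R^-1.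

Definition Gquad (A : forall j : nat, 'M[R]_(r j, r j.+1))
    (B : forall j : nat, 'M[R]_(s j, r j.+1))
    (c : forall j : nat, 'rV[R]_(r j.+1)) (z : var) : R :=
  \sum_(j < N.+1)
    (rho j / 2 * enorm (delta j *: x_ z j.+1 - x_ z j *m A j
                        - w_ z j *m B j - c j) ^+ 2
     + mu_w / 2 * enorm (w_ z j) ^+ 2).

Definition linA (z : var) (j : nat) : 'M[R]_(r j, r j.+1) :=
  if j == 0%N then 0 else 'J (fun x => H j (w_ z j) x) (x_ z j).

Definition linB (z : var) (j : nat) : 'M[R]_(s j, r j.+1) :=
  'J (fun w => H j w (x_ z j)) (w_ z j).

(* [conform_mx 0 y] is y, whose type 'rV_(r N.+1) is only equal to
   'rV_(r j.+1) through the test j == N. *)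
Definition linc (z : var) (j : nat) : 'rV[R]_(r j.+1) :=
  H j (w_ z j) (x_ z j) - x_ z j *m linA z j - w_ z j *m linB z j
  - (if j == N then conform_mx 0 y else beta^-1 *: lambda_ j).

Variables eta1 eta2 eps : R.

Definition is_the_minimizer (f : var -> R) : var -> Prop :=
  unique (fun u => forall v, f u <= f v).

Definition armijo (z p : var) (tau : R) : Prop :=
  Lagr (z + tau *: p) <=
  Lagr z - eta2 * tau * Gquad (linA z) (linB z) (fun j => 0) p.

Definition is_steplength (z p : var) (tau : R) : Prop :=
  [/\ exists k : nat, tau = eta1 ^+ k,
      armijo z p tau
    & forall k : nat, armijo z p (eta1 ^+ k) -> eta1 ^+ k <= tau].

Definition gn_step (z z' : var) : Prop :=
  exists zbar tau,
    [/\ is_the_minimizer (Gquad (linA z) (linB z) (linc z)) zbar,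
        is_steplength z (zbar - z) tau
      & z' = z + tau *: (zbar - z)].

Definition gn_stop (z : var) : Prop := `|grad Lagr z| <= eps.

Definition gn_returns (z0 : var) (n : nat) (zout : var) : Prop :=
  exists zs : nat -> var,
    [/\ zs 0%N = z0,
        forall l, (l <= n)%N -> gn_step (zs l) (zs l.+1),
        forall l, (l < n)%N -> ~ gn_stop (zs l.+1),
        gn_stop (zs n.+1)
      & zout = zs n.+1].

(* The algorithm is deterministic, so the existence of a terminating run means
   that the run from z0 terminates. *)
Lemma gn_step_inj (z z1 z2 : var) : gn_step z z1 -> gn_step z z2 -> z1 = z2.
Proof.
move=> [b1 [t1 [[m1 u1] [[k1 e1] a1 l1] ->]]].
move=> [b2 [t2 [[m2 u2] [[k2 e2] a2 l2] ->]]].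
have eb : b1 = b2 by apply: u1.
subst b2; suff -> : t1 = t2 by [].
apply/eqP; rewrite eq_le; apply/andP; split.
- by rewrite e1; apply: l2; rewrite -e1.
- by rewrite e2; apply: l1; rewrite -e2.
Qed.

End GaussNewton.

(* Main.v *)
Require Import Defs.
From HB Require Import structures.
From mathcomp Require Import ring lra.
Import Order.TTheory GRing.Theory Num.Theory.
Import numFieldNormedType.Exports.

Set Implicit Arguments.
Unset Strict Implicit.
Unset Printing Implicit Defensive.

Local Open Scope classical_set_scope.
Local Open Scope ring_scope.

(** Up to a constant, the augmented Lagrangian is a weighted sum of squares of C^1
    residuals F_i, and the quadratic model minimized at z is the same sum with each
    F_i replaced by its linearization at z. The linearized residuals determine the
    direction: the weights are read off directly, and then the states one layer after
    the other, because A_1 = 0. Hence M(z) = sum_i a_i (grad F_i)^T (grad F_i) is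
    positive definite, the minimizer is z + p(z) with p(z) = - grad L(z) M(z)^-1, p is
    continuous, and L has slope - p M p^T = - 2 G(p) along p.
    Around a point where grad L does not vanish, the mean value theorem and continuity
    give a uniform interval of steps that pass the Armijo test, so every step from that
    neighbourhood lowers L by a fixed amount. The sublevel sets of L are bounded (again
    layer by layer), so if the gradient stayed above eps the iterates would cluster at
    such a point, which contradicts the monotonicity of L. *)

(** * Continuity of matrices, determinants and inverses *)

Lemma continuous_mx {T U : topologicalType} m n (f : T -> 'M[U]_(m, n)) :
  (forall i j, continuous (fun t => f t i j)) -> continuous f.
Proof.
move=> fc x A [P fxP sPA].
apply: (@filterS _ _ _ [set t | forall i j, P i j (f t i j)]).
  by move=> t /sPA.
by do 2 ![apply: filter_forall => ?]; exact/fc/fxP.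
Qed.

Section ContinuousAlgebra.
Context {R : realType} {T : topologicalType}.
Implicit Types f g : T -> R.

Lemma continuous_add f g :
  continuous f -> continuous g -> continuous (fun t => f t + g t).
Proof. by move=> cf cg t; exact: (cvgD (cf t) (cg t)). Qed.

Lemma continuous_mul f g :
  continuous f -> continuous g -> continuous (fun t => f t * g t).
Proof. by move=> cf cg t; exact: (cvgM (cf t) (cg t)). Qed.

Lemma continuous_opp f : continuous f -> continuous (fun t => - f t).
Proof. by move=> cf t; exact: (cvgN (cf t)). Qed.

Lemma continuous_inv f :
  (forall t, f t != 0) -> continuous f -> continuous (fun t => (f t)^-1).
Proof. by move=> f0 cf t; exact: (cvgV (f0 t) (cf t)). Qed.

Lemma continuous_sum (I : Type) (r : seq I) (P : pred I) (F : I -> T -> R) :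
  (forall i, P i -> continuous (F i)) ->
  continuous (fun t => \sum_(i <- r | P i) F i t).
Proof. exact/continuous_big/add_continuous. Qed.

Lemma continuous_prod (I : Type) (r : seq I) (P : pred I) (F : I -> T -> R) :
  (forall i, P i -> continuous (F i)) ->
  continuous (fun t => \prod_(i <- r | P i) F i t).
Proof. exact/continuous_big/mul_continuous. Qed.

End ContinuousAlgebra.

Section ContinuousDet.
Context {R : realType} {T : topologicalType} (n : nat) (A : T -> 'M[R]_n).
Hypothesis cA : forall i j, continuous (fun t => A t i j).

Lemma continuous_det : continuous (fun t => \det (A t)).
Proof.
apply: continuous_sum => s _; apply: continuous_mul; first exact: cst_continuous.
by apply: continuous_prod => i _; exact: cA.
Qed.
End ContinuousDet.

(** By Cramer's rule the entries are cofactors divided by a determinant that vanishes nowhere. *)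
Lemma continuous_invmx {R : realType} {T : topologicalType} n (A : T -> 'M[R]_n) :
  (forall t, A t \in unitmx) -> (forall i j, continuous (fun t => A t i j)) ->
  forall i j, continuous (fun t => invmx (A t) i j).
Proof.
move=> uA cA i j.
have -> : (fun t => invmx (A t) i j) = (fun t => (\det (A t))^-1 * \adj (A t) i j).
  by apply/funext => u; rewrite /invmx uA mxE.
apply: continuous_mul.
  apply: continuous_inv; last exact: continuous_det.
  by move=> t; have := uA t; rewrite unitmxE unitfE.
rewrite (_ : (fun _ => _) = fun t => cofactor (A t) j i); last first.
  by apply/funext => u; rewrite mxE.
apply: continuous_mul; first exact: cst_continuous.
apply: continuous_det => k l u.
rewrite (_ : (fun _ => _) = fun t => A t (lift j k) (lift i l)); first exact: cA.
by apply/funext => v; rewrite !mxE.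
Qed.

(** * Derivatives along lines and the Armijo condition *)

Lemma derive_grad {R : realType} n (f : 'rV[R]_n -> R) z v :
  differentiable f z -> 'D_v f z = \sum_i v 0 i * grad f z 0 i.
Proof.
move=> df; rewrite deriveE// [in LHS](row_sum_delta v) linear_sum.
by apply: eq_bigr => i _; rewrite linearZ mxE deriveE.
Qed.

Lemma mean_value_line {R : realType} (V : normedModType R) (f : V -> R) z v t :
  (forall u, differentiable f u) -> 0 < t ->
  exists2 s, 0 < s < t & f (z + t *: v) - f z = t * 'D_v f (z + s *: v).
Proof.
move=> df t0; pose h s := f (z + s *: v).
have dh (s : R) : is_derive s 1 h ('D_v f (z + s *: v)).
  have : derivable f (z + s *: v) v by exact/diff_derivable/df.
  (* The difference quotients of [h] at [s] and of [f] at [z + s *: v] along [v] coincide, so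
     existence and value of the derivative transfer together. *)
  have eqh : (fun k : R => k^-1 *: ((h \o shift s) (k *: 1) - h s)) =
             (fun k => k^-1 *: ((f \o shift (z + s *: v)) (k *: v) - f (z + s *: v))).
    apply/funext => k; rewrite /h /= /shift /=.
    by rewrite [k *: 1]mulr1 scalerDl [_ + (_ + s *: v)]addrCA.
  by split; rewrite /derivable /derive eqh.
have ch : {within `[0, t], continuous h}.
  apply: derivable_within_continuous => s _.
  by have [] := dh s.
have [s st e] := MVT t0 (fun s _ => dh s) ch.
exists s; first by rewrite in_itv/= in st.
by rewrite mulrC -[X in _ * X]subr0 -e /h scale0r addr0.
Qed.

(** With [L] the Lagrangian and [q] the value at [p] of the quadratic model with zero offsets, this
    and [backtracking_step] become [armijo] and [is_steplength]. *)
Definition sufficient_decrease {R : realType} (V : normedModType R)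
  (L : V -> R) (eta2 q : R) (z p : V) (tau : R) :=
  L (z + tau *: p) <= L z - eta2 * tau * q.

Definition backtracking_step {R : realType} (V : normedModType R)
  (L : V -> R) (eta1 eta2 q : R) (z p : V) (tau : R) :=
  [/\ exists k : nat, tau = eta1 ^+ k,
      sufficient_decrease L eta2 q z p tau
    & forall k : nat, sufficient_decrease L eta2 q z p (eta1 ^+ k) ->
        eta1 ^+ k <= tau].

(** * Line search along a Newton-type direction *)

Section Descent.
Variables (R : realType) (n : nat) (L : 'rV[R]_n -> R) (M : 'rV[R]_n -> 'M[R]_n).
Variables eta1 eta2 eps : R.
Hypotheses (heta1 : 0 < eta1 < 1) (heta2 : 0 < eta2 < 1) (heps : 0 < eps).
Hypothesis dL : forall z, differentiable L z.
Hypothesis cgrad : forall i, continuous (fun z => grad L z 0 i).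
Hypothesis cM : forall i j, continuous (fun z => M z i j).

Definition qform (A : 'M[R]_n) (v : 'rV[R]_n) : R := (v *m A *m v^T) 0 0.

Hypothesis M_gt0 : forall z v, v != 0 -> 0 < qform (M z) v.

Definition newton_dir z := - grad L z *m invmx (M z).

Lemma positive_form_unit z : M z \in unitmx.
Proof.
rewrite unitmxE unitfE; apply/negP => /det0P[v v0 vM].
by have := M_gt0 z v0; rewrite /qform vM mul0mx mxE ltxx.
Qed.

Lemma newton_dirM z : newton_dir z *m M z = - grad L z.
Proof. by rewrite mulmxKV// positive_form_unit. Qed.

Lemma newton_dir_eq0 z : (newton_dir z == 0) = (grad L z == 0).
Proof.
apply/eqP/eqP => [p0|g0]; last by rewrite /newton_dir g0 oppr0 mul0mx.
by apply: oppr_inj; rewrite -newton_dirM p0 mul0mx oppr0.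
Qed.

Lemma derive_newton_dir z :
  'D_(newton_dir z) L z = - qform (M z) (newton_dir z).
Proof.
rewrite derive_grad// /qform newton_dirM mulNmx mxE opprK mxE.
by apply: eq_bigr => i _; rewrite [_^T _ _]mxE mulrC.
Qed.

Lemma continuous_grad : continuous (grad L).
Proof. by apply: continuous_mx => i j; rewrite (ord1 i); exact: (@cgrad j). Qed.

Lemma continuous_newton_dir i : continuous (fun z => newton_dir z 0 i).
Proof.
rewrite (_ : (fun _ => _) =
    fun z => \sum_j (- grad L z 0 j) * invmx (M z) j i); last first.
  by apply/funext => z; rewrite mxE; apply: eq_bigr => j _; rewrite [in LHS]mxE.
apply: continuous_sum => j _; apply: continuous_mul.
  by apply: continuous_opp; exact: (@cgrad j).
exact: continuous_invmx positive_form_unit cM j i.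
Qed.

(** For the Gauss-Newton matrix this is the number [q] of the Armijo test. The slope of [L] along
    [newton_dir z] is [- 2 * model z], so a factor [eta2 < 1] leaves a margin. *)
Definition model z := qform (M z) (newton_dir z) / 2.

Lemma continuous_model : continuous model.
Proof.
apply: continuous_mul; last exact: cst_continuous.
rewrite (_ : (fun _ => _) = fun z =>
  \sum_j (\sum_i newton_dir z 0 i * M z i j) * newton_dir z 0 j); last first.
  apply/funext => z; rewrite /qform mxE; apply: eq_bigr => j _.
  by rewrite mxE [X in _ * X]mxE.
apply: continuous_sum => j _; apply: continuous_mul; last exact: (@continuous_newton_dir j).
apply: continuous_sum => i _; apply: continuous_mul => //.
exact: (@continuous_newton_dir i).
Qed.

Lemma model_ge0 z : 0 <= model z.
Proof.
apply: divr_ge0 => //; have [->|p0] := eqVneq (newton_dir z) 0.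
  by rewrite /qform !mul0mx mxE.
exact/ltW/M_gt0.
Qed.

Lemma model_gt0 z : grad L z != 0 -> 0 < model z.
Proof. by rewrite -newton_dir_eq0 => p0; rewrite divr_gt0// M_gt0. Qed.

Local Notation decr z tau :=
  (sufficient_decrease L eta2 (model z) z (newton_dir z) tau).
Local Notation bstep z tau :=
  (backtracking_step L eta1 eta2 (model z) z (newton_dir z) tau).

Lemma sufficient_decrease_near z : grad L z != 0 ->
  exists2 e : R, 0 < e & \forall u \near z, forall t, 0 < t < e -> decr u t.
Proof.
move=> gz.
(* The slope of [L] along [newton_dir u] at the point [u.1 + u.2 *: newton_dir u.1], plus [eta2]
   times the model. Joint continuity in point and step makes the bound [e] uniform. *)
pose Phi (u : 'rV[R]_n * R) : R :=
  \sum_i newton_dir u.1 0 i * grad L (u.1 + u.2 *: newton_dir u.1) 0 i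
  + eta2 * model u.1.
have cnd : continuous newton_dir.
  by apply: continuous_mx => i j; rewrite (ord1 i); exact: (@continuous_newton_dir j).
have cfst (W : topologicalType) (h : 'rV[R]_n -> W) :
    continuous h -> continuous (fun u : 'rV[R]_n * R => h u.1).
  by move=> ch u; apply: (continuous_comp _ (ch u.1)); exact: cvg_fst.
have cPhi : continuous Phi.
  apply: continuous_add; last first.
    apply: continuous_mul; first exact: cst_continuous.
    exact: (cfst _ _ continuous_model).
  apply: continuous_sum => i _; apply: continuous_mul.
    exact: (cfst _ _ (@continuous_newton_dir i)).
  move=> u; apply: (@continuous_comp _ _ _
    (fun u : 'rV[R]_n * R => u.1 + u.2 *: newton_dir u.1) (fun z => grad L z 0 i));
    last exact: (@cgrad i).
  apply: cvgD; first exact: cvg_fst.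
  by apply: cvgZ; [exact: cvg_snd|exact: (cfst _ _ cnd)].
(* The value here is [(eta2 - 2) * model z]. *)
have Phi0 : Phi (z, 0) < 0.
  rewrite /Phi /= scale0r addr0 -derive_grad// derive_newton_dir.
  have -> : qform (M z) (newton_dir z) = 2 * model z by rewrite mulrC divfK.
  have := model_gt0 gz; case/andP: heta2 => h0 h1 m0; nra.
have [[U W] /= [Uz /nbhs_ballP[e /= e0 We]] sub] := cvgr_lt _ (cPhi (z, 0)) _ Phi0.
exists e => //; apply: filterS Uz => u Uu t /andP[t0 te].
have [s /andP[s0 st] Ls] := mean_value_line u (newton_dir u) dL t0.
have : Phi (u, s) < 0.
  apply: sub; split => //=; apply: We.
  by rewrite -ball_normE /= sub0r normrN gtr0_norm// (lt_trans st).
rewrite /Phi /= -derive_grad// /sufficient_decrease => Phis.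
(* At the mean value point [s], the Armijo inequality divided by [t] reads [Phi (u, s) <= 0]. *)
rewrite -lerBlDl Ls -mulrA mulrCA -mulrN ler_pM2l//.
by rewrite -subr_le0 opprK ltW.
Qed.

Lemma expr_lt (e : R) : 0 < e -> exists k : nat, eta1 ^+ k < e.
Proof.
case/andP: heta1 => h0 h1 e0.
have /cvgrPdist_lt /(_ _ e0) [k _ kP] : (GRing.exp eta1 : R^nat) @ \oo --> (0 : R).
  by apply: cvg_expr; rewrite gtr0_norm.
exists k; have := kP k (leqnn k).
by rewrite /= sub0r normrN gtr0_norm// exprn_gt0.
Qed.

Lemma backtracking_stepP z : exists tau, bstep z tau.
Proof.
case/andP: heta1 => h0 h1.
have ex : exists k : nat, decr z (eta1 ^+ k).
  (* At a critical point the direction is 0 and the full step passes, both sides being [L z]. *)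
  have [/eqP g0|gz] := eqVneq (grad L z) 0.
    exists 0; move: g0; rewrite -newton_dir_eq0 => /eqP p0.
    by rewrite /sufficient_decrease /model p0 /qform !mul0mx mxE scaler0 addr0
      mul0r mulr0 subr0.
  have [e e0 /nbhs_singleton dz] := sufficient_decrease_near gz.
  by have [k ke] := expr_lt e0; exists k; apply: dz; rewrite exprn_gt0.
(* Powers of [eta1] decrease, so the least passing exponent gives the largest passing step. *)
pose P k := `[< decr z (eta1 ^+ k) >].
have exP : exists k, P k by case: ex => k ?; exists k; apply/asboolP.
case: (ex_minnP exP) => k /asboolP dk kmin.
exists (eta1 ^+ k); split => //; first by exists k.
by move=> l /asboolP /kmin kl; rewrite ler_wiXn2l// ltW.
Qed.

Lemma backtracking_step_le z tau : bstep z tau -> L (z + tau *: newton_dir z) <= L z.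
Proof.
case/andP: heta1 => h1 _; case/andP: heta2 => h2 _.
move=> [[k ->] dz _]; apply: (le_trans dz).
rewrite gerBl; apply: mulr_ge0 (model_ge0 z); apply: mulr_ge0; first exact: ltW.
by apply: exprn_ge0; exact: ltW.
Qed.

(** A power of [eta1] below the uniform bound passes throughout a neighbourhood, so every accepted
    step there is at least that power. *)
Lemma backtracking_step_near z : grad L z != 0 ->
  exists2 c : R, 0 < c & \forall u \near z, forall tau, bstep u tau ->
    L (u + tau *: newton_dir u) <= L u - c.
Proof.
case/andP: heta1 => h1 _; case/andP: heta2 => h2 _.
move=> gz; have [e e0 dz] := sufficient_decrease_near gz.
have [k ke] := expr_lt e0; have m0 := model_gt0 gz.
have ek0 : 0 < eta1 ^+ k by rewrite exprn_gt0.
(* By continuity [model u] stays above half of [model z] near [z]. *)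
exists (eta2 * eta1 ^+ k * (model z / 2)); first by do ![apply: mulr_gt0 => //].
near=> u => tau [_ du taumax]; apply: (le_trans du); rewrite lerB// ler_pM//.
- by rewrite mulr_ge0// ltW.
- by rewrite divr_ge0// model_ge0.
- rewrite ler_pM2l//; apply: taumax; move: (eta1 ^+ k) (conj ek0 ke) => t /andP.
  by move: t; near: u.
- by apply/ltW; near: u; apply: (cvgr_gt _ (@continuous_model z));
     rewrite gtr_pMr// invf_lt1// ltr1n.
Unshelve. all: by end_near. Qed.

Lemma descent_terminates (zs : nat -> 'rV[R]_n) (tau : nat -> R) :
  bounded_set [set z | L z <= L (zs 0)] ->
  (forall l, bstep (zs l) (tau l) /\ zs l.+1 = zs l + tau l *: newton_dir (zs l)) ->
  exists l, `|grad L (zs l.+1)| <= eps.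
Proof.
move=> bK step; apply: contrapT => /forallNP noteps.
have Lmono l k : (l <= k)%N -> L (zs k) <= L (zs l).
  elim: k => [|k IH]; first by rewrite leqn0 => /eqP ->.
  rewrite leq_eqVlt => /predU1P[->//|/IH]; apply: le_trans.
  by have [b ->] := step k; exact: backtracking_step_le b.
have cL : continuous L by move=> z; exact/differentiable_continuous/dL.
have clK : closed [set z | L z <= L (zs 0)].
  by rewrite (_ : mkset _ = L @^-1` [set x | x <= L (zs 0)])//;
     apply: preimage_closed => //; exact: closed_le.
have [z [_ zcl]] : [set z | L z <= L (zs 0)] `&` cluster (zs @ \oo) !=set0.
  by apply: (bounded_closed_compact bK clK); exists 0 => // k _; exact: Lmono.
(* The iterates return to every neighbourhood of the cluster point at arbitrarily late indices. *)
have visits (U : set 'rV[R]_n) k : nbhs z U -> exists2 l, (k <= l)%N & U (zs l).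
  move=> zU; have : (zs @ \oo) (zs @` [set l | (k <= l)%N]).
    by exists k => // l kl; exists l.
  by move=> /zcl /(_ zU) [_ [[l kl <-] Ul]]; exists l.
have gz : grad L z != 0.
  apply/eqP => g0.
  have cn : {for z, continuous (fun u => `|grad L u|)}.
    by apply: continuous_comp; [exact: @continuous_grad|exact: norm_continuous].
  have : `|grad L z| < eps by rewrite g0 normr0.
  (* The visit is taken from index 1 on, because [noteps] speaks only of the iterates [zs l.+1]. *)
  by move=> /(cvgr_lt _ cn) /(visits _ 1%N) [[//|l] _ /ltW /(noteps l)].
have [c c0 cdec] := backtracking_step_near gz.
have c20 : 0 < c / 2 by rewrite divr_gt0.
have ltL : L z < L z + c / 2 by rewrite ltrDl.
have gtL : L z - c / 2 < L z by rewrite gtrBl.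
(* The step from [zs l] ends below [L z - c / 2], yet a later visit near [z] has a value above it,
   against monotonicity. *)
have [l _ [lc lL]] := visits _ 0%N (filterI cdec (cvgr_lt _ (cL z) _ ltL)).
have [k lk kL] := visits _ l.+1 (cvgr_gt _ (cL z) _ gtL).
have [b zl] := step l; have := lc _ b; rewrite -zl => dl.
have := Lmono _ _ lk; lra.
Qed.

End Descent.

(** * Weighted nonlinear least squares *)

Section LeastSquares.
Variables (R : realType) (n : nat) (I : finType).
Variables (a : I -> R) (F : I -> 'rV[R]_n -> R) (C : R).
Hypothesis a_gt0 : forall i, 0 < a i.
Hypothesis dF : forall i z, differentiable (F i) z.
Hypothesis cF : forall i k, continuous (fun z => grad (F i) z 0 k).
Hypothesis F_inj : forall z v, (forall i, 'D_v (F i) z = 0) -> v = 0.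

(** The constant [C] accommodates the term of the Lagrangian in [lambda] alone. *)
Definition lsq z := \sum_i a i / 2 * F i z ^+ 2 + C.
Definition gn_form z v := \sum_i a i / 2 * ('D_v (F i) z) ^+ 2.
Definition gn_model z u := \sum_i a i / 2 * (F i z + 'D_(u - z) (F i) z) ^+ 2.
(** The Hessian of [gn_model z]: the transposed Jacobian of the residuals times the diagonal of
    weights times the Jacobian. *)
Definition gn_mx z := \sum_i a i *: ((grad (F i) z)^T *m grad (F i) z).

Lemma differentiable_lsq z : differentiable lsq z.
Proof.
apply: differentiableD => //.
have -> : (fun z => \sum_i a i / 2 * F i z ^+ 2) =
          \sum_i (fun z => a i / 2 * F i z ^+ 2) by rewrite fct_sumE.
elim/big_ind: _ => [|f g df dg|i _].
- exact: differentiable_cst.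
- exact: differentiableD.
- rewrite (_ : (fun _ => _) = (a i / 2) \*: (F i * F i)).
    by apply/differentiableZ/differentiableM.
  by apply/funext => u.
Qed.

Lemma derive_lsq z v : 'D_v lsq z = \sum_i a i * (F i z * 'D_v (F i) z).
Proof.
have ds (r : seq I) : is_derive z v (fun z => \sum_(i <- r) a i / 2 * F i z ^+ 2)
    (\sum_(i <- r) a i * (F i z * 'D_v (F i) z)).
  elim: r => [|i r IH].
    rewrite big_nil (_ : (fun _ => _) = cst 0); first exact: is_derive_cst.
    by apply/funext => u; rewrite big_nil.
  rewrite big_cons (_ : (fun _ => _) = (a i / 2 \*: (F i * F i)) +
     fun z => \sum_(i <- r) a i / 2 * F i z ^+ 2); last first.
    by apply/funext => u; rewrite big_cons.
  apply: is_deriveD.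
  have dFi : is_derive z v (F i) ('D_v (F i) z) by exact/derivableP/diff_derivable.
  apply: is_derive_eq.
  by rewrite /GRing.scale /=; field.
have dC : is_derive z v (cst C : 'rV[R]_n -> R) 0 by exact: is_derive_cst.
by rewrite -[RHS]addr0; apply: (@derive_val _ _ _ _ _ _ _ (is_deriveD (ds _) dC)).
Qed.

Lemma grad_lsq z : grad lsq z = \sum_i (a i * F i z) *: grad (F i) z.
Proof.
apply/rowP => k; rewrite mxE derive_lsq summxE.
by apply: eq_bigr => i _; rewrite !mxE mulrA.
Qed.

Lemma continuous_grad_lsq k : continuous (fun z => grad lsq z 0 k).
Proof.
rewrite (_ : (fun _ => _) = fun z => \sum_i (a i * F i z) * grad (F i) z 0 k); last first.
  by apply/funext => z; rewrite grad_lsq summxE; apply: eq_bigr => i _; rewrite mxE.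
apply: continuous_sum => i _; apply: continuous_mul; last exact: (@cF i k).
apply: continuous_mul; first exact: cst_continuous.
by move=> z; exact/differentiable_continuous/dF.
Qed.

Lemma continuous_gn_mx k l : continuous (fun z => gn_mx z k l).
Proof.
rewrite (_ : (fun _ => _) =
  fun z => \sum_i a i * (grad (F i) z 0 k * grad (F i) z 0 l)); last first.
  apply/funext => z; rewrite summxE; apply: eq_bigr => i _.
  by rewrite mxE mxE big_ord1 [_^T _ _]mxE.
apply: continuous_sum => i _; apply: continuous_mul; first exact: cst_continuous.
by apply: continuous_mul; [exact: (@cF i k)|exact: (@cF i l)].
Qed.

Lemma grad_dot i z v : (v *m (grad (F i) z)^T) = ('D_v (F i) z)%:M.
Proof.
apply/matrixP => k l; rewrite !ord1 !mxE eqxx mulr1n derive_grad//.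
by apply: eq_bigr => j _; rewrite [_^T _ _]mxE.
Qed.

Lemma gn_mxE z v u :
  (v *m gn_mx z *m u^T) 0 0 = \sum_i a i * ('D_v (F i) z * 'D_u (F i) z).
Proof.
rewrite mulmx_sumr mulmx_suml summxE; apply: eq_bigr => i _.
rewrite -scalemxAr -scalemxAl mxE mulmxA grad_dot mul_scalar_mx -scalemxAl mxE.
congr (_ * (_ * _)); rewrite -[LHS]/(_ 0 0) -[grad _ _]trmxK -trmx_mul grad_dot.
by rewrite !mxE eqxx.
Qed.

Lemma qform_gn_mx z v : qform (gn_mx z) v / 2 = gn_form z v.
Proof.
rewrite /qform gn_mxE mulr_suml; apply: eq_bigr => i _.
by rewrite expr2 mulrAC.
Qed.

(** If the sum of nonnegative terms vanished, so would all derivatives along [v], and [F_inj] would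
    give [v = 0]. *)
Lemma gn_form_gt0 z v : v != 0 -> 0 < gn_form z v.
Proof.
move=> v0; have pos i : 0 <= a i / 2 * 'D_v (F i) z ^+ 2.
  by rewrite mulr_ge0 ?sqr_ge0// divr_ge0// ltW.
rewrite lt_neqAle sumr_ge0// andbT eq_sym; apply: contra v0 => /eqP e.
apply/eqP/(@F_inj z) => i; apply/eqP.
have /eqP := @psumr_eq0P _ _ _ _ (fun j _ => pos j) e i isT.
by rewrite mulf_eq0 sqrf_eq0 gt_eqF ?divr_gt0.
Qed.

Lemma gn_form_ge0 z v : 0 <= gn_form z v.
Proof.
by apply: sumr_ge0 => i _; rewrite mulr_ge0 ?sqr_ge0// divr_ge0// ltW.
Qed.

Lemma qform_gn_mx_gt0 z v : v != 0 -> 0 < qform (gn_mx z) v.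
Proof. by move=> /(gn_form_gt0 z); rewrite -qform_gn_mx pmulr_lgt0// invr_gt0. Qed.

Let dir z := newton_dir lsq gn_mx z.

Lemma derive_linD i z v u : 'D_(v + u) (F i) z = 'D_v (F i) z + 'D_u (F i) z.
Proof. by rewrite !deriveE// linearD. Qed.

(* The cross term vanishes by the normal equations. *)
Lemma gn_model_newton_dir z v :
  gn_model z (z + dir z + v) = gn_model z (z + dir z) + gn_form z v.
Proof.
have cross : \sum_i a i * ((F i z + 'D_(dir z) (F i) z) * 'D_v (F i) z) = 0.
  have := gn_mxE z (dir z) v.
  rewrite /dir newton_dirM; last exact: qform_gn_mx_gt0.
  rewrite -/(dir z) mulNmx mxE grad_lsq mulmx_suml summxE => e.
  rewrite (eq_bigr (fun i => a i * F i z * 'D_v (F i) z +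
     a i * ('D_(dir z) (F i) z * 'D_v (F i) z))); last first.
    by move=> i _; ring.
  rewrite big_split /= -e; apply/eqP; rewrite subr_eq0; apply/eqP.
  apply: eq_bigr => i _; rewrite -scalemxAl mxE; congr (_ * _).
  rewrite -[grad _ _ in RHS]trmxK -trmx_mul grad_dot.
  by rewrite !mxE eqxx.
rewrite /gn_model -[RHS]addr0 -[X in _ = _ + X]cross -!big_split /=; apply: eq_bigr => i _.
have -> : z + dir z + v - z = dir z + v by rewrite addrAC [z + _]addrC addrK.
have -> : z + dir z - z = dir z by rewrite addrC addKr.
by rewrite derive_linD; field.
Qed.

(** Completing the square at [z + dir z]: any other point costs an extra positive value of
    [gn_form z]. *)
Lemma gn_model_unique_min z :
  unique (fun u => forall v, gn_model z u <= gn_model z v) (z + dir z).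
Proof.
have modE v : gn_model z v = gn_model z (z + dir z) + gn_form z (v - (z + dir z)).
  by rewrite -gn_model_newton_dir addrC subrK.
split=> [v|u umin]; first by rewrite [leRHS]modE lerDl gn_form_ge0.
apply/eqP; rewrite eq_sym -subr_eq0; apply/negPn/negP => /(gn_form_gt0 z).
by apply/negP; rewrite -leNgt -(gerDl (gn_model z (z + dir z))) -modE.
Qed.

End LeastSquares.

(** * Block vectors and affine maps *)

Section Blocks.
Variables (R : realType) (d : nat -> nat) (n : nat).
Implicit Types v : 'rV[R]_(\sum_(i < n) d i).

Lemma blockE v (i : 'I_n) (k : 'I_(d i)) :
  block v i 0 k = v 0 (@tagnat.Rank n (fun i => d i) i k).
Proof.
case: i k => j jn k; rewrite /block /=.
case: {-}_ / (@idP (j < n)%N) => [jn'|//].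
by rewrite (bool_irrelevance jn' jn) mxE.
Qed.

Lemma block_ge v j : (n <= j)%N -> block v j = 0.
Proof.
move=> nj; rewrite /block; case: {-}_ / (@idP (j < n)%N) => // jn.
by have := leq_ltn_trans nj jn; rewrite ltnn.
Qed.

Lemma block_linear j : linear (fun v => block v j).
Proof.
move=> a u v; have [nj|jn] := leqP n j; first by rewrite !block_ge// scaler0 addr0.
by apply/rowP => k; rewrite !mxE !(@blockE _ (Ordinal jn)) !mxE.
Qed.

(** Flat positions correspond bijectively to pairs of a block and a position in it. *)
Lemma sum_block (f : R -> R) v :
  \sum_k f (v 0 k) = \sum_(i < n) \sum_(k < d i) f (block v i 0 k).
Proof.
rewrite (sig_big_dep xpredT (fun=> xpredT)) /=.
rewrite (reindex _ (@tagnat.rank_bij_on n (fun i => d i))) /=.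
by apply: eq_bigr => -[i k] _; rewrite blockE tagnat.rankE.
Qed.

End Blocks.

Lemma sqr_enorm (R : realType) n (v : 'rV[R]_n) :
  enorm v ^+ 2 = \sum_k v 0 k ^+ 2.
Proof. by rewrite sqr_sqrtr// sumr_ge0// => k _; rewrite sqr_ge0. Qed.

(** In finite dimension a linear map is continuous, coordinate by coordinate, hence is its own
    differential. *)
Lemma linear_rV_is_diff (R : realType) p q (f : 'rV[R]_p -> 'rV[R]_q) c z :
  linear f -> is_diff z (fun u => f u + c) f.
Proof.
move=> lf; pose g : {linear 'rV[R]_p -> 'rV[R]_q} :=
  HB.pack f (GRing.isLinear.Build R 'rV[R]_p 'rV[R]_q _ f lf).
have cg : continuous g.
  apply: continuous_mx => i j.
  rewrite (_ : (fun _ => _) = fun t : 'rV[R]_p => \sum_k t i k * lin1_mx g k j); last first.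
    by apply/funext => t; rewrite -mul_rV_lin1 mxE.
  apply: continuous_sum => k _; apply: continuous_mul; last exact: cst_continuous.
  exact: coord_continuous.
have dg : is_diff z g g.
  by apply: DiffDef; [exact: linear_differentiable|exact: diff_lin].
have dc : is_diff z (cst c : 'rV[R]_p -> 'rV[R]_q) 0 by exact: is_diff_cst.
by apply: is_diff_eq (is_diffD dg dc) _; rewrite addr0.
Qed.

Lemma diff_affine_comp (R : realType) p q n (f : 'rV[R]_p -> 'rV[R]_q) c
    (G : 'rV[R]_q -> 'rV[R]_n) z v : linear f -> differentiable G (f z + c) ->
  'd (fun u => G (f u + c)) z v = 'd G (f z + c) (f v).
Proof.
move=> lf /differentiableP dG.
have d := @is_diff_comp _ _ _ _ _ _ G _ _ (linear_rV_is_diff c z lf) dG.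
by rewrite (@diff_val _ _ _ _ _ _ _ d).
Qed.

(** * Norm bounds and bounded sublevel sets *)

Lemma rV_norm_le (R : realType) n (v : 'rV[R]_n) B : 0 <= B ->
  (forall k, `|v 0 k| <= B) -> `|v| <= B.
Proof.
move=> B0 vB; rewrite [leLHS]/Num.Def.normr/= mx_normrE.
by apply: bigmax_le => // -[i j] _; rewrite ord1 vB.
Qed.

Lemma rV_coord_le (R : realType) n (v : 'rV[R]_n) k : `|v 0 k| <= `|v|.
Proof.
rewrite [leRHS]/Num.Def.normr/= mx_normrE.
exact: (le_bigmax _ (fun ij => `|v ij.1 ij.2|) (0, k)).
Qed.

Lemma continuous_rV_bounded (R : realType) p q (f : 'rV[R]_p -> 'rV[R]_q) C :
  continuous f -> exists D, forall u, `|u| <= C -> `|f u| <= D.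
Proof.
move=> cf; have cpt : compact [set u : 'rV[R]_p | `|u| <= C].
  apply: bounded_closed_compact.
    by exists C; split=> [|M CM u /= uC]; rewrite ?num_real// (le_trans uC)// ltW.
  rewrite (_ : mkset _ = (fun u : 'rV[R]_p => `|u|) @^-1` [set x | x <= C])//.
  by apply: preimage_closed; [move=> u _; exact: norm_continuous|exact: closed_le].
have /compact_bounded[M [_ MP]] : compact (f @` [set u : 'rV[R]_p | `|u| <= C]).
  by apply: continuous_compact => //; exact: continuous_subspaceT.
exists (M + 1) => u uC; apply: (MP (M + 1)); first by rewrite ltrDl.
by exists u.
Qed.

Lemma derive_coord (R : realType) p q (f : 'rV[R]_p -> 'rV[R]_q) z v k :
  differentiable f z -> 'D_v (fun z => f z 0 k) z = 'd f z v 0 k.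
Proof.
by move=> df; rewrite -deriveE// derive_mx ?mxE//; exact: diff_derivable.
Qed.

Lemma differentiable_coord_comp (R : realType) p q (f : 'rV[R]_p -> 'rV[R]_q) z k :
  differentiable f z -> differentiable (fun z => f z 0 k) z.
Proof.
move=> df; apply: (@differentiable_comp _ _ _ _ f (fun M : 'rV[R]_q => M 0 k)) => //.
exact: (differentiable_coord (f z) 0 k).
Qed.

(** On a sublevel set each term of the nonnegative sum is at most [c - C], which bounds every
    residual separately. *)
Lemma lsq_sublevel_bounded (R : realType) n (I : finType) (a : I -> R)
    (F : I -> 'rV[R]_n -> R) C c : (forall i, 0 < a i) ->
  (forall B, 0 <= B -> bounded_set [set z | forall i, `|F i z| <= B]) ->
  bounded_set [set z | lsq a F C z <= c].
Proof.
(* A number whose square is at most [t] is at most [1 + t]; the sum over [i] gives one bound for all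
   residuals. *)
move=> a0 bF; pose B := 1 + \sum_i 2 * `|c - C| / a i.
have t0 i : 0 <= 2 * `|c - C| / a i by rewrite divr_ge0// ltW.
have B0 : 0 <= B by rewrite addr_ge0// sumr_ge0.
have [M [Mr MP]] := bF B B0; exists M; split=> // K MK z /= zc; apply: (MP K MK) => i.
have le_t : a i / 2 * F i z ^+ 2 <= `|c - C|.
  apply: le_trans (ler_norm _); rewrite lerBrDr; apply: le_trans zc.
  rewrite /lsq (bigD1 i)//= lerD2r lerDl sumr_ge0// => k _.
  by rewrite mulr_ge0 ?sqr_ge0// divr_ge0// ltW.
have le_B : 1 + 2 * `|c - C| / a i <= B.
  by rewrite /B lerD2l (bigD1 i)//= lerDl sumr_ge0.
apply: le_trans le_B; have : `|F i z| ^+ 2 <= 2 * `|c - C| / a i.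
  rewrite ler_pdivlMr// real_normK ?num_real//.
  by have := le_t; have := a0 i; nra.
by have := normr_ge0 (F i z); nra.
Qed.

Lemma sqr_enormN (R : realType) n (v : 'rV[R]_n) : enorm (- v) ^+ 2 = enorm v ^+ 2.
Proof. by rewrite !sqr_enorm; apply: eq_bigr => k _; rewrite mxE sqrrN. Qed.

Lemma linear_sub (R : pzRingType) (U W : lmodType R) (f : U -> W) u v :
  linear f -> f (u - v) = f u - f v.
Proof. by move=> lf; rewrite addrC -scaleN1r lf scaleN1r addrC. Qed.

(** * The layered residuals *)

Section Layers.
Variables (R : realType) (N m : nat) (r s : nat -> nat).
Variable H : forall j : nat, 'rV[R]_(s j) -> 'rV[R]_(r j) -> 'rV[R]_(r j.+1).
Variable x0 : 'rV[R]_(r 0%N).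
Variable lambda : 'rV[R]_(\sum_(i < N) r i.+1).
Variable y : 'rV[R]_(r N.+1).
Variables beta mu_w : R.
Hypotheses (hm : (1 <= m)%N) (hbeta : 0 < beta) (hmu : 0 < mu_w).
Hypothesis hH : forall j : nat, (j <= N)%N -> C1 (@H j).

Local Notation V := (var R N r s).
Implicit Types (z v u p : V) (j : nat).
Local Notation linA := (linA H x0).
Local Notation linB := (linB H x0).
Local Notation linc := (linc H x0 lambda y beta).
Local Notation Gq := (Gquad m x0 beta mu_w).
Local Notation L := (Lagr m H x0 lambda y beta mu_w).

Lemma w_linear j : linear (fun z => w_ z j).
Proof. by move=> a u v; rewrite /w_ linearP block_linear. Qed.

(* [x_ 0 z j] is the linear part of the affine map [x_ x0 ^~ j]. *)
Lemma x_linear j : linear (fun z => x_ 0 z j).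
Proof.
case: j => [|j] a u v /=; first by rewrite scaler0 addr0.
by rewrite linearP block_linear.
Qed.

(** The constant part is [x0] for [j = 0] and 0 for every later state. *)
Lemma x_affine z j : x_ x0 z j = x_ 0 z j + x_ x0 (0 : V) j.
Proof.
case: j => [|j] /=; first by rewrite add0r.
rewrite -[X in _ = X + _]scale1r -block_linear scale1r.
by rewrite linear0 addr0.
Qed.

(** The function of the joint variable whose differentiability [C1] asserts. *)
Definition uncurryH j (u : 'rV[R]_(s j + r j)) := H (lsubmx u) (rsubmx u).
Definition layer_input z j := row_mx (w_ z j) (x_ x0 z j).
Definition layer_dir v j := row_mx (w_ v j) (x_ 0 v j).

Lemma uncurryH_input z j : uncurryH (layer_input z j) = H (w_ z j) (x_ x0 z j).
Proof. by rewrite /uncurryH row_mxKl row_mxKr. Qed.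

Lemma layer_input_affine z j : layer_input z j = layer_dir z j + layer_input 0 j.
Proof.
rewrite /layer_input /layer_dir add_row_mx -x_affine.
by congr row_mx; rewrite -[RHS]scale1r -[X in _ *: (X + _)]scale1r -w_linear !scale1r addr0.
Qed.

Lemma layer_dir_linear j : linear (fun v => layer_dir v j).
Proof.
by move=> a u v; rewrite /layer_dir w_linear x_linear scale_row_mx add_row_mx.
Qed.

Lemma layer_input_is_diff z j : is_diff z (layer_input ^~ j) (layer_dir ^~ j).
Proof.
rewrite (_ : layer_input ^~ j = fun z => layer_dir z j + layer_input 0 j).
  exact/linear_rV_is_diff/layer_dir_linear.
by apply/funext => u; exact: layer_input_affine.
Qed.

Lemma differentiable_layer_input z j : differentiable (layer_input ^~ j) z.
Proof. by have h := layer_input_is_diff z j; apply: ex_diff. Qed.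

(** Freezing the state is precomposition with an affine map, so the partial Jacobian is the total
    differential on vectors with zero state part. *)
Lemma linBE z j (dw : 'rV[R]_(s j)) : (j <= N)%N ->
  dw *m linB z j = 'd (@uncurryH j) (layer_input z j) (row_mx dw 0).
Proof.
move=> /hH[dH _]; rewrite /linB /jacobian mul_rV_lin1.
have lin : linear (fun w : 'rV[R]_(s j) => row_mx w (0 : 'rV[R]_(r j))).
  by move=> a u v; rewrite scale_row_mx add_row_mx scaler0 addr0.
have -> : (fun w => H w (x_ x0 z j)) =
    fun w => @uncurryH j (row_mx w 0 + row_mx 0 (x_ x0 z j)).
  by apply/funext => w; rewrite /uncurryH add_row_mx addr0 add0r row_mxKl row_mxKr.
rewrite (@diff_affine_comp _ _ _ _ _ (row_mx 0 (x_ x0 z j)) (@uncurryH j) _ _ lin).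
  by rewrite add_row_mx addr0 add0r.
exact: dH.
Qed.

Lemma linAE v z j : (j <= N)%N ->
  x_ 0 v j *m linA z j = 'd (@uncurryH j) (layer_input z j) (row_mx 0 (x_ 0 v j)).
Proof.
(* For [j = 0] both sides vanish: [linA] is 0 by definition, and the initial state is fixed, so its
   variation [x_ 0 v 0] is 0. *)
rewrite /linA; have [->{j} _|_] := eqVneq j 0%N.
  by rewrite /= mul0mx row_mx0 linear0.
move=> /hH[dH _]; rewrite /jacobian mul_rV_lin1.
have lin : linear (fun x : 'rV[R]_(r j) => row_mx (0 : 'rV[R]_(s j)) x).
  by move=> a u w; rewrite scale_row_mx add_row_mx scaler0 addr0.
have -> : (fun x => H (w_ z j) x) =
    fun x => @uncurryH j (row_mx 0 x + row_mx (w_ z j) 0).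
  by apply/funext => x; rewrite /uncurryH add_row_mx addr0 add0r row_mxKl row_mxKr.
rewrite (@diff_affine_comp _ _ _ _ _ (row_mx (w_ z j) 0) (@uncurryH j) _ _ lin).
  by rewrite add_row_mx addr0 add0r.
exact: dH.
Qed.

Lemma diff_layer z v j : (j <= N)%N ->
  'd (@uncurryH j) (layer_input z j) (layer_dir v j) =
  x_ 0 v j *m linA z j + w_ v j *m linB z j.
Proof.
move=> jN; rewrite linAE// linBE// -linearD add_row_mx add0r addr0.
by [].
Qed.

Definition offset j : 'rV[R]_(r j.+1) :=
  if j == N then conform_mx 0 y else beta^-1 *: lambda_ lambda j.

(** Below [N] this is the constraint violation shifted by the scaled multiplier. At [N], where
    [delta] is 0, it is [y] minus the network output. *)
Definition res j z : 'rV[R]_(r j.+1) :=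
  delta R N j *: x_ x0 z j.+1 - H (w_ z j) (x_ x0 z j) + offset j.

Definition dres j z v : 'rV[R]_(r j.+1) :=
  delta R N j *: x_ 0 v j.+1 - (x_ 0 v j *m linA z j + w_ v j *m linB z j).

Lemma res_is_diff z j : (j <= N)%N -> is_diff z (res j) (dres j z).
Proof.
move=> jN; have [dH _] := hH jN.
(* States with a successor index do not involve [x0], so this map is linear and not merely
   affine. *)
have dx : is_diff z (fun z => x_ x0 z j.+1) (fun v => x_ 0 v j.+1).
  rewrite [X in is_diff _ X _](_ : _ = fun z => x_ 0 z j.+1 + 0).
    exact: (linear_rV_is_diff 0 z (@x_linear j.+1)).
  by apply/funext => u; rewrite addr0.
have dHj : is_diff (layer_input z j) (@uncurryH j) ('d (@uncurryH j) (layer_input z j)).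
  exact/differentiableP/dH.
have dHl := @is_diff_comp _ _ _ _ (layer_input ^~ j) _ (@uncurryH j) _ _
  (layer_input_is_diff z j) dHj.
have dc : is_diff z (cst (offset j) : V -> _) 0 by exact: is_diff_cst.
rewrite (_ : res j = delta R N j \*: (fun z => x_ x0 z j.+1) -
  (@uncurryH j \o layer_input ^~ j) + cst (offset j)); last first.
  by apply/funext => u; rewrite /res -uncurryH_input.
apply: is_diff_eq.
apply/funext => v; rewrite /dres addr0 -diff_layer//.
Qed.

(** One index for each scalar square: the coordinates of the layer residuals and, for the
    regularization, those of the weights. *)
Definition residual_index : finType :=
  ({j : 'I_N.+1 & 'I_(r j.+1)} + {j : 'I_N.+1 & 'I_(s j)})%type.

Definition state_index (j : 'I_N.+1) (k : 'I_(r j.+1)) : residual_index :=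
  inl (Tagged (fun j : 'I_N.+1 => 'I_(r j.+1)) k).

Definition weight_index (j : 'I_N.+1) (k : 'I_(s j)) : residual_index :=
  inr (Tagged (fun j : 'I_N.+1 => 'I_(s j)) k).

Definition resid (i : residual_index) z : R :=
  match i with
  | inl p => res (tag p) z 0 (tagged p)
  | inr p => w_ z (tag p) 0 (tagged p)
  end.

Definition weight (i : residual_index) : R :=
  if i is inl p then rho N m beta (tag p) else mu_w.

Lemma weight_gt0 i : 0 < weight i.
Proof.
case: i => [[j k]|//]; rewrite /weight /rho /=.
by case: ifP => // _; rewrite invr_gt0 ltr0n.
Qed.

Lemma w_is_diff z j : is_diff z (fun z => w_ z j) (fun v => w_ v j).
Proof.
rewrite [X in is_diff _ X _](_ : _ = fun z => w_ z j + 0).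
  exact: (linear_rV_is_diff 0 z (@w_linear j)).
by apply/funext => u; rewrite addr0.
Qed.

Lemma res_differentiable z j : (j <= N)%N -> differentiable (res j) z.
Proof. by move=> jN; have d := res_is_diff z jN; apply: ex_diff. Qed.

Lemma w_differentiable z j : differentiable (fun z => w_ z j) z.
Proof. by have d := w_is_diff z j; apply: ex_diff. Qed.

Lemma resid_differentiable i z : differentiable (resid i) z.
Proof.
case: i => -[j k]; apply: differentiable_coord_comp => /=; last exact: w_differentiable.
by apply: res_differentiable; rewrite -ltnS.
Qed.

Lemma derive_resid i z v : 'D_v (resid i) z =
  match i with
  | inl p => dres (tag p) z v 0 (tagged p)
  | inr p => w_ v (tag p) 0 (tagged p)
  end.
Proof.
case: i => -[j k] /=.
  have jN : (j <= N)%N by rewrite -ltnS.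
  rewrite (derive_coord _ _ (res_differentiable z jN)).
  by have d := res_is_diff z jN; rewrite (@diff_val _ _ _ _ _ _ _ d).
rewrite (derive_coord _ _ (w_differentiable z j)).
by have d := w_is_diff z j; rewrite (@diff_val _ _ _ _ _ _ _ d).
Qed.

(** Each entry is a constant plus a fixed linear combination of entries of the joint Jacobian of one
    layer, continuous by [C1]. *)
Lemma continuous_grad_resid i l : continuous (fun z => grad (resid i) z 0 l).
Proof.
rewrite (_ : (fun _ => _) = fun z => 'D_(delta_mx 0 l) (resid i) z); last first.
  by apply/funext => z; rewrite mxE.
move: (delta_mx 0 l) => v.
rewrite (_ : (fun _ => _) = fun z => match i with
  | inl p => dres (tag p) z v 0 (tagged p)
  | inr p => w_ v (tag p) 0 (tagged p)
  end); last by apply/funext => z; rewrite derive_resid.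
case: i => -[j k] /=; last exact: cst_continuous.
have jN : (j <= N)%N by rewrite -ltnS.
have [_ cJ] := hH jN.
rewrite (_ : (fun _ => _) = fun z => (delta R N j *: x_ 0 v j.+1) 0 k +
    - \sum_l layer_dir v j 0 l * ('J (@uncurryH j) (layer_input z j)) l k); last first.
  apply/funext => z; rewrite /dres mxE [X in _ + X]mxE; congr (_ - _).
  by rewrite -diff_layer// -mul_rV_lin1 mxE.
apply: continuous_add; first exact: cst_continuous.
apply/continuous_opp/continuous_sum => q _.
apply: continuous_mul; first exact: cst_continuous.
have cq : continuous (fun t => 'J (@uncurryH j) t q k).
  move=> t; apply: (@continuous_comp _ _ _ _ (fun M : 'M[R]_(_, _) => M q k)).
    exact: cJ.
  exact: coord_continuous.
have cl : continuous (fun z => layer_input z j : 'rV[R]_(s j + r j)).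
  by move=> z; exact/differentiable_continuous/differentiable_layer_input.
by move=> z; exact: (@continuous_comp _ _ _ _ _ z (cl z) (cq _)).
Qed.

(** * Layerwise recovery of the variables from the residuals *)

Lemma var_entry (l : 'I_(\sum_(i < N.+1) s i + \sum_(i < N) r i.+1)) :
  (exists (j : 'I_N.+1) (k : 'I_(s j)), forall z, z 0 l = w_ z j 0 k) \/
  (exists (j : 'I_N) (k : 'I_(r j.+1)), forall z, z 0 l = x_ x0 z j.+1 0 k).
Proof.
rewrite -(fintype.splitK l); case: (fintype.split l) => q /=; [left|right].
  exists (tagnat.sig1 q), (tagnat.sig2 q) => z.
  by rewrite /w_ blockE mxE tagnat.sig2K.
exists (tagnat.sig1 q), (tagnat.sig2 q) => z.
by rewrite /= (blockE (d := fun i => r i.+1)) mxE tagnat.sig2K.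
Qed.

(** The weight residuals give the weights of [v] directly. Then [dres j = 0] expresses state [j.+1]
    through layer [j], and induction starts from the zero variation of the initial state. *)
Lemma derive_resid_inj z v : (forall i, 'D_v (resid i) z = 0) -> v = 0.
Proof.
move=> D0.
have w0 j : (j <= N)%N -> w_ v j = 0.
  move=> jN; apply/rowP => k; rewrite mxE.
  by have := D0 (@weight_index (Ordinal (jN : (j < N.+1)%N)) k); rewrite derive_resid.
have x_0 j : (j <= N)%N -> x_ 0 v j = 0.
  elim: j => [//|j IH] jN.
  have jN1 : (j < N.+1)%N by exact: ltnW.
  have := IH (ltnW jN); have := w0 j (ltnW jN) => wj xj.
  apply/rowP => k; rewrite [RHS]mxE.
  have := D0 (@state_index (Ordinal jN1) k).
  rewrite derive_resid /= /dres /delta jN wj xj !mul0mx addr0 subr0 scale1r.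
  by [].
apply/rowP => l; rewrite [RHS]mxE.
have [[j [k ->]]|[j [k ->]]] := var_entry l.
  by rewrite w0 ?mxE// -ltnS.
by have := x_0 j.+1 (ltn_ord j) => /= ->; rewrite mxE.
Qed.

(** Forward induction: state [j.+1] is the residual plus the layer output minus the offset, and a
    continuous layer is bounded on bounded inputs. *)
Lemma x_bounded B j : 0 <= B -> (j <= N)%N ->
  exists C, forall z, (forall i, `|resid i z| <= B) -> `|x_ x0 z j| <= C.
Proof.
move=> B0; elim: j => [|j IH] jN; first by exists `|x0|.
have [C Cx] := IH (ltnW jN).
have [dH _] := hH (ltnW jN).
have cU : continuous (@uncurryH j).
  by move=> u; exact/differentiable_continuous/dH.
(* In the max norm this radius covers the weights, bounded by [B], and the state, bounded by [C],
   whose sign is unknown. *)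
have [D Dx] := continuous_rV_bounded (`|B| + `|C|) cU.
exists (B + D + `|offset j|) => z zB.
have jN1 : (j < N.+1)%N by exact: ltnW.
have -> : x_ x0 z j.+1 =
    res j z + uncurryH (layer_input z j) - offset j.
  rewrite uncurryH_input /res /delta jN scale1r addrAC addrK.
  by rewrite subrK.
apply: (le_trans (ler_normB _ _)); rewrite lerD2r.
apply: (le_trans (ler_normD _ _)); apply: lerD.
  apply: rV_norm_le => // k.
  exact: (zB (@state_index (Ordinal jN1) k)).
apply: Dx; apply: rV_norm_le => [|k]; first by rewrite addr_ge0.
rewrite mxE; case: fintype.split => q.
  apply: ler_wpDr => //; apply: le_trans (ler_norm B).
  exact: (zB (@weight_index (Ordinal jN1) q)).
apply: ler_wpDl => //; apply: le_trans (ler_norm C).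
exact: le_trans (rV_coord_le _ _) (Cx z zB).
Qed.

Lemma resid_bounded B : 0 <= B -> bounded_set [set z | forall i, `|resid i z| <= B].
Proof.
move=> B0.
have /choice[C Cx] (j : 'I_N.+1) : exists C, forall z,
    (forall i, `|resid i z| <= B) -> `|x_ x0 z j| <= C.
  by apply: x_bounded => //; rewrite -ltnS.
pose M := B + \sum_j `|C j|.
have M0 : 0 <= \sum_j `|C j| by rewrite sumr_ge0.
exists M; split=> [|K MK z /= zB]; first exact: num_real.
apply: le_trans (ltW MK); apply: rV_norm_le => [|l]; first exact: addr_ge0.
have [[j [k ->]]|[j [k ->]]] := var_entry l.
  apply: ler_wpDr => //.
  exact: (zB (weight_index k)).
apply: ler_wpDl => //; apply: (le_trans (rV_coord_le _ _)).
(* Block [j] of the state part is state [j.+1], whence the shifted ordinal. *)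
apply: (le_trans (Cx (Ordinal (ltn_ord j : (j.+1 < N.+1)%N)) z zB)).
rewrite (bigD1 (Ordinal (ltn_ord j : (j.+1 < N.+1)%N)))//=.
by apply: ler_wpDr; [exact: sumr_ge0|exact: ler_norm].
Qed.

(** * Identification with the Lagrangian and the quadratic model *)

Lemma sum_residual_index (f : residual_index -> R) :
  \sum_i f i = \sum_(j < N.+1)
    (\sum_(k < r j.+1) f (state_index k) +
     \sum_(k < s j) f (weight_index k)).
Proof.
rewrite big_sumType /= big_split /=; congr (_ + _).
  rewrite (sig_big_dep xpredT (fun=> xpredT)
    (fun (j : 'I_N.+1) (k : 'I_(r j.+1)) => f (state_index k))) /=.
  by apply: eq_bigr => -[].
rewrite (sig_big_dep xpredT (fun=> xpredT)
  (fun (j : 'I_N.+1) (k : 'I_(s j)) => f (weight_index k))) /=.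
by apply: eq_bigr => -[].
Qed.

Lemma w_sub u z j : w_ (u - z) j = w_ u j - w_ z j.
Proof. exact/(linear_sub (f := fun z => w_ z j))/w_linear. Qed.

Lemma x_sub u z j : x_ 0 (u - z) j = x_ 0 u j - x_ 0 z j.
Proof. exact/(linear_sub (f := fun z => x_ 0 z j))/x_linear. Qed.

(** Regroups scalar squares into layer norms; it serves for the residuals, their derivatives and
    their linearizations alike. *)
Lemma sum_weight (a : forall j, 'rV[R]_(r j.+1)) (b : forall j, 'rV[R]_(s j)) :
  \sum_(i : residual_index) weight i / 2 * (match i with
     | inl p => a (tag p) 0 (tagged p)
     | inr p => b (tag p) 0 (tagged p)
     end) ^+ 2
  = \sum_(j < N.+1) (rho N m beta j / 2 * enorm (a j) ^+ 2 +
                     mu_w / 2 * enorm (b j) ^+ 2).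
Proof.
rewrite sum_residual_index; apply: eq_bigr => j _ /=.
by rewrite !sqr_enorm !mulr_sumr.
Qed.

Lemma resN z : res N z = - (H (w_ z N) (x_ x0 z N) - y).
Proof.
by rewrite /res /delta ltnn scale0r add0r /offset eqxx conform_mx_id opprB addrC.
Qed.

Lemma Lagr_lsq : L = lsq weight resid (- ((2 * beta)^-1 * enorm lambda ^+ 2)).
Proof.
apply/funext => z; rewrite /lsq.
rewrite (eq_bigr (fun i => weight i / 2 * (match i with
     | inl p => res (tag p) z 0 (tagged p)
     | inr p => w_ z (tag p) 0 (tagged p)
     end) ^+ 2)); last by case.
rewrite (sum_weight (res ^~ z) (w_ z)) big_split /= -mulr_sumr.
have -> : \sum_(j < N.+1) enorm (w_ z j) ^+ 2 = enorm (lsubmx z) ^+ 2.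
  rewrite sqr_enorm (sum_block (fun t => t ^+ 2)).
  by apply: eq_bigr => j _; rewrite sqr_enorm.
(* The last layer is split off: its weight [m%:R^-1] yields the data term, and the other layers
   yield the penalty. *)
rewrite big_ord_recr /= {2}/rho ltnn resN sqr_enormN -invfM [m%:R * 2]mulrC.
rewrite /Lagr mulr_sumr.
rewrite [in RHS](eq_bigr (fun j : 'I_N => beta / 2 * enorm (x_ x0 z j.+1 -
  H (w_ z j) (x_ x0 z j) + beta^-1 *: lambda_ lambda j) ^+ 2)); last first.
  move=> j _; rewrite /rho ltn_ord /res /delta ltn_ord scale1r /offset.
  by rewrite ltn_eqF.
by ring.
Qed.

(** The two sides could differ only in state 0, which [linA z 0 = 0] annihilates. This is why the
    Armijo value does not depend on [x0]. *)
Lemma x_linA z p j : x_ x0 p j *m linA z j = x_ 0 p j *m linA z j.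
Proof. by case: j => [|//]; rewrite /linA eqxx !mulmx0. Qed.

Lemma delta_x p j : delta R N j *: x_ x0 p j.+1 = delta R N j *: x_ 0 p j.+1.
Proof. by []. Qed.

Lemma gn_form_Gquad z p :
  gn_form weight resid z p = Gq (linA z) (linB z) (fun=> 0) p.
Proof.
rewrite /gn_form; under eq_bigr do rewrite derive_resid//.
rewrite (sum_weight (dres ^~ z ^~ p) (w_ p)) /Gquad; apply: eq_bigr => j _.
by rewrite x_linA subr0 /dres opprD addrA.
Qed.

(** In the residual plus its derivative along [u - z], all terms evaluated at [z] collect into
    [- linc z j]. *)
Lemma gn_model_Gquad z u :
  gn_model weight resid z u = Gq (linA z) (linB z) (linc z) u.
Proof.
rewrite /gn_model (eq_bigr (fun i => weight i / 2 * (match i with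
     | inl p => (res (tag p) z + dres (tag p) z (u - z)) 0 (tagged p)
     | inr p => (w_ z (tag p) + w_ (u - z) (tag p)) 0 (tagged p)
     end) ^+ 2)); last first.
  move=> i _; rewrite derive_resid//.
  by case: i => [p|p] /=; congr (_ * _ ^+ 2); rewrite [RHS]mxE.
rewrite (sum_weight (fun j => res j z + dres j z (u - z))
  (fun j => w_ z j + w_ (u - z) j)) /Gquad; apply: eq_bigr => j _.
rewrite w_sub [w_ z j + _]addrC subrK; congr (_ / 2 * enorm _ ^+ 2 + _).
rewrite x_linA delta_x /dres /res /linc -/(offset j).
rewrite !x_sub w_sub.
rewrite !delta_x !x_linA scalerBr !mulmxBl.
move: (H _ _) (offset _) (_ *: _) (_ *: _) (_ *m _) (_ *m _) (_ *m _) (_ *m _).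
move=> h e xu xz zA uA zB uB.
by apply/rowP => k; rewrite !mxE; ring.
Qed.

Let C := - ((2 * beta)^-1 * enorm lambda ^+ 2).
Let dir z := newton_dir (lsq weight resid C) (gn_mx weight resid) z.

(** The unique minimizer is [z + dir z], and [model] is the quadratic model with zero offsets at
    [dir z], so the abstract line search is that of the algorithm. *)
Lemma gn_step_backtracking eta1 eta2 z tau :
  backtracking_step (lsq weight resid C) eta1 eta2
    (model (lsq weight resid C) (gn_mx weight resid) z) z (dir z) tau ->
  gn_step m H x0 lambda y beta mu_w eta1 eta2 z (z + tau *: dir z).
Proof.
have Gdir : model (lsq weight resid C) (gn_mx weight resid) z =
    Gq (linA z) (linB z) (fun=> 0) (dir z).
  rewrite -gn_form_Gquad -qform_gn_mx//.
  by move=> i u; exact: resid_differentiable.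
have dirE : z + dir z - z = dir z by rewrite addrC addKr.
rewrite Gdir -Lagr_lsq => bz; exists (z + dir z), tau; split; rewrite ?dirE//.
rewrite (_ : Gq _ _ _ = gn_model weight resid z); last first.
  by apply/funext => u; rewrite gn_model_Gquad.
apply: gn_model_unique_min.
- exact: weight_gt0.
- by move=> i u; exact: resid_differentiable.
- by move=> u v; exact: derive_resid_inj.
Qed.

End Layers.

Theorem lemma6 (R : realType) (N m : nat) (hN : (1 <= N)%N) (hm : (1 <= m)%N)
  (r s : nat -> nat)
  (beta mu_w : R) (hbeta : 0 < beta) (hmu : 0 < mu_w)
  (x0 : 'rV[R]_(r 0%N))
  (H : forall j : nat, 'rV[R]_(s j) -> 'rV[R]_(r j) -> 'rV[R]_(r j.+1))
  (hH : forall j : nat, (j <= N)%N -> C1 (H j))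
  (lambda : 'rV[R]_(\sum_(i < N) r i.+1))
  (y : 'rV[R]_(r N.+1))
  (z0 : var R N r s)
  (eta1 eta2 eps : R)
  (heta1 : 0 < eta1 < 1) (heta2 : 0 < eta2 < 1) (heps : 0 < eps) :
  exists (n : nat) (z : var R N r s),
    gn_returns m H x0 lambda y beta mu_w eta1 eta2 eps z0 n z /\
    `|grad (Lagr m H x0 lambda y beta mu_w) z| <= eps.
Proof.
pose a := @weight R N m r s beta mu_w.
pose F := resid H x0 lambda y beta.
pose C := - ((2 * beta)^-1 * enorm lambda ^+ 2).
have LE : Lagr m H x0 lambda y beta mu_w = lsq a F C := Lagr_lsq m H x0 lambda y beta mu_w.
have a0 i : 0 < a i by exact: weight_gt0.
have dF i z : differentiable (F i) z by exact: resid_differentiable.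
have cF i k : continuous (fun z => grad (F i) z 0 k) by exact: continuous_grad_resid.
have injF z v : (forall i, 'D_v (F i) z = 0) -> v = 0 by exact: derive_resid_inj.
have dL z : differentiable (lsq a F C) z by exact: differentiable_lsq.
have cg k : continuous (fun z => grad (lsq a F C) z 0 k) by exact: continuous_grad_lsq.
have cM k l : continuous (fun z => gn_mx a F z k l) by exact: continuous_gn_mx.
have M0 z v : v != 0 -> 0 < qform (gn_mx a F z) v by exact: qform_gn_mx_gt0.
(* Choosing a step length at every point turns the run into the iteration of one map. *)
have /choice[tau tauP] := backtracking_stepP heta1 heta2 dL cg cM M0.
pose step z := z + tau z *: newton_dir (lsq a F C) (gn_mx a F) z.
pose zs l := iter l step z0.
have bnd : bounded_set [set z | lsq a F C z <= lsq a F C (zs 0%N)].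
  by apply: lsq_sublevel_bounded => // B B0; exact: resid_bounded.
have [l stopl] := descent_terminates heta1 heta2 heps dL cg cM M0 bnd
  (fun l => conj (tauP (zs l)) (erefl (zs l.+1))).
(* The run must end at the first stopping iterate, so the least such index is taken; the test starts
   at [zs 1]. *)
have ex : exists l, `[< gn_stop m H x0 lambda y beta mu_w eps (zs l.+1) >].
  by exists l; apply/asboolP; rewrite /gn_stop LE.
case: (ex_minnP ex) => n /asboolP stopn nmin.
exists n, (zs n.+1); split=> //; exists zs; split=> // k kn.
  exact/gn_step_backtracking/tauP.
by move=> /asboolP /nmin; rewrite leqNgt kn.
Qed.
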